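(* Let $\{X_n\}_{n\ge 0}$ be the reflecting random walk on the half-strip $S=\{0,1,2,\ldots\}\times\{1,\ldots,d\}$ with blocks $P_0$ and $(P_n,Q_n,R_n)_{n\ge1}$ satisfying conditions $C_1$, $C_2$, $C_3$ (all as described in the context). Suppose that $$\varrho_1^{+}=\mathbf 1' P_0\Big(\sum_{k\ge1}A_1^{-}A_2^{-}\cdots A_{k-1}^{-}\mathbf u_k^{-}\Big)+d<\infty$$ and that the walk starts from layer $0$ with the censored measure $\breve\mu_0$. Then the stationary distribution $\{\nu_n\}_{n\ge0}$ (where $\nu_n$ is the row vector $(\nu_n(1),\ldots,\nu_n(d))$ of stationary probabilities of the states of layer $n$) exists and is unique, and it is given by $$\nu_n=\frac{\breve\mu_0P_0A_1^{-}A_2^{-}\cdots A_{n-1}^{-}\,\widetilde u_n^{-}}{\breve\mu_0P_0\big(\sum_{k\ge1}A_1^{-}A_2^{-}\cdots A_{k-1}^{-}\mathbf u_k^{-}\big)+\breve\mu_0\mathbf 1}\quad(n>0),$$ $$\nu_0=\frac{\breve\mu_0}{\breve\mu_0P_0\big(\sum_{k\ge1}A_1^{-}A_2^{-}\cdots A_{k-1}^{-}\mathbf u_k^{-}\big)+\breve\mu_0\mathbf 1},$$ where $\widetilde u_n^{-}=(I-P_n\zeta_{n+1}^{-}-R_n)^{-1}$ and $\breve\mu_0P_0\big(\sum_{k\ge1}A_1^{-}\cdots A_{k-1}^{-}\mathbf u_k^{-}\big)+\breve\mu_0\mathbf 1\le\varrho_1^{+}<\infty$. (Empty matrix products are the 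identity.)
   Context: Setting: let $d\ge 1$ be an integer. $X_n=(\xi_n,Y_n)$, $n\ge0$, is a time-homogeneous Markov chain on $S=\{0,1,2,\ldots\}\times\{1,\ldots,d\}$; layer $n$ is $L_n=\{(n,i):1\le i\le d\}$. There are nonnegative $d\times d$ matrices $P_0$ and $P_n,Q_n,R_n$ ($n\ge1$) with $P_0\mathbf 1=\mathbf 1$ and $(P_n+Q_n+R_n)\mathbf 1=\mathbf 1$ for $n\ge 1$, where $\mathbf 1$ is the column vector of ones and $\mathbf 1'$ its transpose. From $(0,i)$ the chain moves to $(1,j)$ with probability $P_0(i,j)$; from $(n,i)$ with $n\ge1$ it moves to $(n+1,j)$, $(n,j)$, $(n-1,j)$ with probability $P_n(i,j)$, $R_n(i,j)$, $Q_n(i,j)$ respectively. Standing conditions (under which the chain is irreducible), with $\|B\|=\max_i\sum_j|b_{ij}|$: $C_1$: for every $n\ge1$, $\log(1-\|R_n+P_n\|)^{-1}<\infty$ and $\log(1-\|R_n+Q_n\|)^{-1}<\infty$ (i.e. both norms are $<1$). $C_2$: for every $n$ and $j$, $\sum_{i=1}^d P_n(i,j)>0$ ($n\ge0$) and $\sum_{i=1}^d Q_n(i,j)>0$ ($n\ge1$). $C_3$: all states of layer $0$ lie in one communication class. Definitions: let $\rho$ be a stochastic $d\times d$ matrix. For $a\ge1$ put $\zeta_{a,a}^{-}=\rho$ and, for $1\le n<a$, $\zeta_{n,a}^{-}=(I-P_n\zeta_{n+1,a}^{-}-R_n)^{-1}Q_n$. It is part of the setting (taken as given from the literature) that for each $n\ge1$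 the limit $\zeta_n^{-}=\lim_{a\to\infty}\zeta_{n,a}^{-}$ exists; the $\zeta_n^-$ are stochastic and satisfy $\zeta_n^{-}=(I-P_n\zeta_{n+1}^{-}-R_n)^{-1}Q_n$. For $n\ge1$, $$A_n^{-}=(I-P_n\zeta_{n+1}^{-}-R_n)^{-1}P_n,\qquad \mathbf u_n^{-}=(I-P_n\zeta_{n+1}^{-}-R_n)^{-1}\mathbf 1 .$$ Censored measure: write the transition matrix of the chain in block form according to $S_0=L_0$ and $S_1=S\setminus L_0$ as $\begin{pmatrix}\mathbf 0&U\\ D&\breve P_1\end{pmatrix}$, with $U=(P_0,O,O,\ldots)$, $D$ the block column $(Q_1,O,O,\ldots)^{T}$, and $\breve P_1$ the restriction of the transition matrix to $S_1$. The censored matrix is the $d\times d$ matrix $\breve P^{(S_0)}=U\big(\sum_{k\ge0}\breve P_1^{\,k}\big)D$; its $(i,j)$ entry is the probability that, starting at $(0,i)$, the next visited state of layer $0$ is $(0,j)$. The censored measure $\breve\mu_0$ is a probability row vector with $\breve\mu_0\breve P^{(S_0)}=\breve\mu_0$. *)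

(* Defs.v *)
From HB Require Import structures.
From mathcomp Require Import all_boot all_order all_algebra.
From mathcomp Require Import all_classical all_reals all_analysis.

Set Implicit Arguments.
Unset Strict Implicit.
Unset Printing Implicit Defensive.
Import Order.TTheory GRing.Theory Num.Theory.
Import numFieldNormedType.Exports.
Local Open Scope classical_set_scope.
Local Open Scope ring_scope.

Section countable_chains.
Context {K : realType} {S : choiceType}.
Implicit Types (p : S -> S -> K) (B : set S) (x y : S).

(* k-th power of the block of p with rows and columns in B, for x, y \in B;
   with B = setT, the k-step transition probabilities. The sums are sums of
   nonnegative terms, taken in the extended reals. *)
Fixpoint kernel_pow p B (k : nat) x y : \bar K :=
  if k is k'.+1 then
    (\esum_(z in B) ((p x z)%:E * kernel_pow p B k' z y))%E
  else ((x == y)%:R)%:E.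

Definition accessible p x y := exists k, (0 < kernel_pow p setT k x y)%E.

Definition communicate p x y := accessible p x y /\ accessible p y x.

Definition stationary_distribution p (pi : S -> K) :=
  [/\ forall x, 0 <= pi x,
      (\esum_(x in setT) (pi x)%:E = 1)%E &
      forall y, (\esum_(x in setT) (pi x * p x y)%:E = (pi y)%:E)%E].

End countable_chains.

Section half_strip.
Context {K : realType} {d : nat}.
Implicit Types (P Q R : nat -> 'M[K]_d) (rho : 'M[K]_d) (n a : nat).

Definition ones : 'cV[K]_d := const_mx 1.

Definition nonneg_mx m1 m2 (M : 'M[K]_(m1, m2)) := forall i j, 0 <= M i j.

Definition stochastic_mx (M : 'M[K]_d) := nonneg_mx M /\ M *m ones = ones.

(* max_i sum_j |b_ij|; the library's mx_norm is the largest |b_ij| instead. *)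
Definition row_sum_norm (M : 'M[K]_d) : K :=
  \big[Num.max/0]_(i < d) \sum_(j < d) `|M i j|.

(* Q 0 and R 0 play no role anywhere below. *)
Definition strip_blocks P Q R :=
  [/\ nonneg_mx (P 0),
      P 0 *m ones = ones,
      forall n, (0 < n)%N ->
        [/\ nonneg_mx (P n), nonneg_mx (Q n) & nonneg_mx (R n)] &
      forall n, (0 < n)%N -> (P n + Q n + R n) *m ones = ones].

Definition strip_trans P Q R (x y : nat * 'I_d) : K :=
  let: (m, i) := x in let: (n, j) := y in
  if n == m.+1 then P m i j
  else if m == 0%N then 0
  else if n == m then R m i j
  else if n.+1 == m then Q m i j
  else 0.

(* log (1 - ||.||)^-1 < oo amounts to ||.|| < 1. *)
Definition cond_C1 P Q R := forall n, (0 < n)%N ->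
  row_sum_norm (R n + P n) < 1 /\ row_sum_norm (R n + Q n) < 1.

Definition cond_C2 P Q :=
  (forall n j, 0 < \sum_(i < d) P n i j) /\
  (forall n j, (0 < n)%N -> 0 < \sum_(i < d) Q n i j).

Definition cond_C3 P Q R := forall i j : 'I_d,
  communicate (strip_trans P Q R) (0%N, i) (0%N, j).

Definition resolvent P R n (Z : 'M[K]_d) : 'M[K]_d :=
  invmx (1%:M - P n *m Z - R n).

(* zeta_rec k n is zeta^-_{n, n + k}. *)
Fixpoint zeta_rec P Q R rho (k n : nat) : 'M[K]_d :=
  if k is k'.+1 then
    resolvent P R n (zeta_rec P Q R rho k' n.+1) *m Q n
  else rho.

Definition zeta_cut P Q R rho n a : 'M[K]_d := zeta_rec P Q R rho (a - n) n.

Definition zeta P Q R rho n : 'M[K]_d :=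
  lim (zeta_cut P Q R rho n a @[a --> \oo]).

Definition u_tilde P Q R rho n : 'M[K]_d :=
  resolvent P R n (zeta P Q R rho n.+1).

Definition A_minus P Q R rho n : 'M[K]_d := u_tilde P Q R rho n *m P n.

Definition u_minus P Q R rho n : 'cV[K]_d := u_tilde P Q R rho n *m ones.

(* A_1 A_2 ... A_{k-1}, in this order. *)
Definition A_prod P Q R rho k : 'M[K]_d :=
  \big[mulmx/1%:M]_(1 <= l < k) A_minus P Q R rho l.

(* Entries of the column sum_{k >= 1} A_1 ... A_{k-1} u_k, possibly +oo. *)
Definition A_series P Q R rho (i : 'I_d) : \bar K :=
  (\sum_(1 <= k <oo) ((A_prod P Q R rho k *m u_minus P Q R rho k) i ord0)%:E)%E.

(* Row vector times extended-real column. *)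
Definition row_pairing (w : 'rV[K]_d) (s : 'I_d -> \bar K) : \bar K :=
  (\sum_(i < d) (w ord0 i)%:E * s i)%E.

Definition varrho1 P Q R rho : \bar K :=
  (row_pairing (ones^T *m P 0%N) (A_series P Q R rho) + (d%:R)%:E)%E.

Definition normalizer P Q R rho (mu : 'rV[K]_d) : \bar K :=
  (row_pairing (mu *m P 0%N) (A_series P Q R rho)
   + ((mu *m ones) ord0 ord0)%:E)%E.

Definition upper_layers : set (nat * 'I_d) := [set x | (0 < x.1)%N].

(* (U (sum_{k >= 0} P1^k) D)(i, j), where U, D and P1 are the blocks of the
   transition matrix from layer 0 to upper_layers, from upper_layers to layer 0,
   and inside upper_layers. *)
Definition censored P Q R (i j : 'I_d) : \bar K :=
  let p := strip_trans P Q R in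
  (\esum_(x in upper_layers) \esum_(y in upper_layers)
     ((p (0%N, i) x)%:E * (\sum_(0 <= k <oo) kernel_pow p upper_layers k x y)
      * (p y (0%N, j))%:E))%E.

Definition censored_measure P Q R (mu : 'rV[K]_d) :=
  [/\ nonneg_mx mu,
      \sum_(i < d) mu ord0 i = 1 &
      forall j, row_pairing mu (censored P Q R ^~ j) = (mu ord0 j)%:E].

(* nu n is the row vector of the masses of the states of layer n. *)
Definition strip_stationary P Q R (nu : nat -> 'rV[K]_d) :=
  stationary_distribution (strip_trans P Q R) (fun x => nu x.1 ord0 x.2).

End half_strip.

(* Main.v *)
From HB Require Import structures.
Require Import Defs.
From mathcomp Require Import all_boot all_order all_algebra.
From mathcomp Require Import all_classical all_reals all_analysis zify.
Set Implicit Arguments.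
Unset Strict Implicit.
Unset Printing Implicit Defensive.
Import Order.TTheory GRing.Theory Num.Theory.
Import numFieldNormedType.Exports.
Local Open Scope classical_set_scope.
Local Open Scope ring_scope.

(** Put [v_0 = mu] and [v_n = mu P_0 A_1 ... A_{n-1} u~_n]. Since
    [v_n P_n = mu P_0 A_1 ... A_n] and [zeta_n = u~_n Q_n], the balance equation
    at a layer [n > 0] is the definition of [u~_n] as an inverse, and the one at
    layer 0 is [mu P_0 zeta_1 = mu]. For the latter, the products
    [zeta_n ... zeta_1] form a nonnegative harmonic function equal to the
    identity on layer 0, so they dominate the minimal one, the hitting
    probabilities of layer 0; hence the censored matrix is at most
    [P_0 zeta_1], and [mu <= mu P_0 zeta_1] is an equality of vectors of the
    same mass 1. The total mass of [v] is the normalizer. Uniqueness holds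
    because a state of layer 0 is accessible from every state. *)

(** * Sums over countable sets and countable chains *)

Lemma esumZl (K : realType) (T : choiceType) (B : set T) (c : K)
    (a : T -> \bar K) :
  0 <= c -> (forall x, 0 <= a x)%E ->
  (\esum_(x in B) (c%:E * a x) = c%:E * \esum_(x in B) a x)%E.
Proof.
(* Scaling the supremum requires a nonempty family of finite partial sums; the empty set provides a
   member. *)
move=> c0 a0; rewrite /esum -ereal_supZl//; last first.
  apply/set0P; exists (\sum_(x \in set0) a x)%E; exists set0 => //.
  exact: fsets_set0.
congr ereal_sup; rewrite image_comp; apply: eq_imagel => A [finA AB] /=.
by rewrite ge0_mule_fsumr.
Qed.

(** Tonelli for nonnegative families: both sides are sums over the product set, matched by swapping
    coordinates. *)
Lemma exchange_esum (K : realType) (T U : choiceType) (A : set T) (B : set U)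
    (a : T -> U -> \bar K) : (forall x y, 0 <= a x y)%E ->
  (\esum_(x in A) \esum_(y in B) a x y = \esum_(y in B) \esum_(x in A) a x y)%E.
Proof.
move=> a0; rewrite !esum_esum//.
rewrite (reindex_esum (A `*`` (fun=> B)) _ (fun z => (z.2, z.1)))//.
split=> [[x y] [/= Ax By]|[x y] [x' y'] _ _ /= [-> ->]//|[y x] [/= By Ax]] //.
by exists (x, y).
Qed.

Lemma le_esum_term (K : realType) (T : choiceType) (B : set T)
    (a : T -> \bar K) x :
  B x -> (forall y, 0 <= a y)%E -> (a x <= \esum_(y in B) a y)%E.
Proof.
move=> Bx a0; apply: esum_ge; exists [set x]; last by rewrite fsbig_set1.
by split=> // _ ->.
Qed.

Lemma esum_eq1 (K : realType) (T : choiceType) (B : set T)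
    (a : T -> \bar K) x :
  B x -> (0 <= a x)%E -> (forall y, y != x -> a y = 0)%E ->
  (\esum_(y in B) a y = a x)%E.
Proof.
move=> Bx ax0 a0; have ge0 y : B y -> (0 <= a y)%E.
  by move=> _; have [->//|/a0->] := eqVneq y x.
rewrite (esumID [set x])// [X in (_ + X)%E]esum1 ?adde0.
  rewrite (_ : B `&` [set x] = [set x]) ?esum_set1//.
  by apply/seteqP; split=> [y []//|y ->].
by move=> y [_ /eqP/a0].
Qed.

Lemma esum_gt0P (K : realType) (T : choiceType) (B : set T)
    (a : T -> \bar K) :
  (forall y, 0 <= a y)%E ->
  (0 < \esum_(y in B) a y)%E -> exists2 y, B y & (0 < a y)%E.
Proof.
move=> a0; apply: contraPP => /forall2NP h; rewrite esum1 ?ltxx// => y By.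
by have [//|/negP] := h y; rewrite lt_neqAle a0 andbT negbK => /eqP.
Qed.

(** Cancelling the finite mass of [a] leaves a nonpositive sum for the nonnegative family [b - a],
    so every term of it vanishes. *)
Lemma esum_le_eq (K : realType) (T : choiceType) (a b : T -> K) :
  (forall x, 0 <= a x <= b x) ->
  (\esum_(x in setT) (b x)%:E <= \esum_(x in setT) (a x)%:E)%E ->
  (\esum_(x in setT) (a x)%:E < +oo)%E -> a =1 b.
Proof.
move=> ab leS finS x.
have a0 y : (0 <= (a y)%:E)%E by rewrite lee_fin; case/andP: (ab y).
have c0 y : (0 <= (b y - a y)%:E)%E.
  by rewrite lee_fin subr_ge0; case/andP: (ab y).
have finA : (\esum_(x in setT) (a x)%:E)%E \is a fin_num.
  by rewrite ge0_fin_numE// esum_ge0.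
have e : (\esum_(x in setT) (b x)%:E =
    \esum_(x in setT) (a x)%:E + \esum_(x in setT) (b x - a x)%:E)%E.
  rewrite -esumD//; apply: eq_esum => y _.
  by rewrite -EFinD addrC subrK.
move: leS; rewrite e -[leRHS]adde0 leeD2lE//.
move=> /(le_trans (@le_esum_term _ _ setT _ x I c0)).
rewrite lee_fin subr_le0 => ba; apply/eqP; rewrite eq_le ba andbT.
by case/andP: (ab x).
Qed.

(** * Invariant weights, uniqueness and hitting probabilities for a countable chain *)

Section chain.
Context {K : realType} {S : choiceType} (p : S -> S -> K).
Hypothesis p_ge0 : forall x y, 0 <= p x y.

Lemma kernel_pow_ge0 B k x y : (0 <= kernel_pow p B k x y)%E.
Proof.
elim: k x => [|k IH] x /=; first by rewrite lee_fin ler0n.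
by apply: esum_ge0 => z _; rewrite mule_ge0// lee_fin.
Qed.

(** Stationarity without sign or normalization, so that it also covers differences of stationary
    distributions and unnormalized weights. *)
Definition invariant_weight (g : S -> K) :=
  forall y, (\esum_(x in setT) (g x * p x y)%:E = (g y)%:E)%E.

Lemma accessible_step x y o :
  0 < p x y -> accessible p y o -> accessible p x o.
Proof.
move=> pxy [k ko]; exists k.+1 => /=.
apply: lt_le_trans (@le_esum_term _ _ setT _ y I _); last first.
  by move=> z; rewrite mule_ge0 ?kernel_pow_ge0// lee_fin.
by rewrite mule_gt0.
Qed.

(** Positivity spreads along paths: [g z >= g x * p x z > 0] whenever [p x z > 0]. Induction on the
    length of the path. *)
Lemma invariant_gt0 g x o : (forall x, 0 <= g x) -> invariant_weight g ->
  accessible p x o -> 0 < g x -> 0 < g o.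
Proof.
move=> g0 gI [k]; elim: k x => [|k IH] x /=.
  by case: eqVneq => [->|_]; rewrite /= ?ltxx.
move=> /esum_gt0P[z|z _]; first by rewrite mule_ge0 ?kernel_pow_ge0 ?lee_fin.
rewrite mule_ge0_gt0 ?kernel_pow_ge0 ?lee_fin// => /andP[+ zo] gx.
rewrite lte_fin => pxz; apply: IH zo _; rewrite -lte_fin -gI.
apply: lt_le_trans (@le_esum_term _ _ setT _ x I _).
  by rewrite lte_fin mulr_gt0.
by move=> y; rewrite lee_fin mulr_ge0.
Qed.

Hypothesis p_sum1 : forall x, (\esum_(y in setT) (p x y)%:E = 1)%E.

(* The minimum [m] of two stationary distributions satisfies [m p <= m], with
   equality because [m p] and [m] have the same mass; hence both differences
   with [m] are invariant_weight, and they have disjoint supports. *)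
Lemma stationary_le o pi1 pi2 : (forall x, accessible p x o) ->
  stationary_distribution p pi1 -> stationary_distribution p pi2 ->
  forall x, pi1 x <= pi2 x.
Proof.
move=> acc [pi1_ge0 pi1_sum pi1_inv] [pi2_ge0 pi2_sum pi2_inv] x.
pose m y := Num.min (pi1 y) (pi2 y).
have m0 y : 0 <= m y by rewrite /m le_min pi1_ge0 pi2_ge0.
have m1 y : m y <= pi1 y by rewrite /m ge_min lexx.
have m2 y : m y <= pi2 y by rewrite /m ge_min lexx orbT.
have m0E y : (0 <= (m y)%:E)%E by rewrite lee_fin.
have mp0 y z : (0 <= (m y * p y z)%:E)%E by rewrite lee_fin mulr_ge0.
have le_mp y : (\esum_(x in setT) (m x * p x y)%:E <= (m y)%:E)%E.
  rewrite {2}/m EFin_min le_min -pi1_inv -pi2_inv.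
  by apply/andP; split; apply: le_esum => z _; rewrite lee_fin ler_wpM2r.
have mpf y : (\esum_(x in setT) (m x * p x y)%:E)%E \is a fin_num.
  by rewrite ge0_fin_numE ?esum_ge0//; apply: le_lt_trans (le_mp y) (ltry _).
have mI : invariant_weight m.
  move=> y; rewrite -[LHS]fineK//; congr EFin; move: y.
  (* Tonelli and the unit row sums of [p] give [m p] the mass of [m]. *)
  have E : (\esum_(y in setT) (fine (\esum_(x in setT) (m x * p x y)%:E))%:E =
       \esum_(x in setT) (m x)%:E)%E.
    under eq_esum do rewrite fineK//.
    rewrite exchange_esum//; apply: eq_esum => y _.
    under eq_esum do rewrite EFinM.
    by rewrite esumZl// ?p_sum1 ?mule1// => z; rewrite lee_fin.
  apply: esum_le_eq.
  - move=> y; rewrite fine_ge0 ?esum_ge0//=.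
    by rewrite -lee_fin fineK.
  - by rewrite E.
  - rewrite E; apply: (@le_lt_trans _ _ 1%E); last exact: ltry.
    rewrite -pi1_sum.
    by apply: le_esum => y _; rewrite lee_fin.
have diffI q : (forall y, m y <= q y) -> invariant_weight q ->
    invariant_weight (fun y => q y - m y).
  move=> mq qI y; have := qI y.
  rewrite (_ : (\esum_(x in setT) (q x * p x y)%:E = (m y)%:E +
     \esum_(x in setT) ((q x - m x) * p x y)%:E)%E).
    (* This sum is nonnegative and adds up with [m y] to a real number, so it is finite and [m y]
       can be subtracted. *)
    move=> h; have: (0 <= \esum_(x in setT) ((q x - m x) * p x y)%:E)%E.
      by apply: esum_ge0 => z _; rewrite lee_fin mulr_ge0 ?subr_ge0.
    case: (esum _ _) h => [r [<-] _| |]//=.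
    by rewrite [m y + r]addrC addrK.
  rewrite -(mI y) -esumD//; first last.
    by move=> z _; rewrite lee_fin mulr_ge0 ?subr_ge0.
  by apply: eq_esum => z _; rewrite -EFinD -mulrDl [m z + _]addrC subrK.
have massD q : (forall y, m y <= q y) -> (\esum_(y in setT) (q y)%:E =
     \esum_(y in setT) (m y)%:E + \esum_(y in setT) (q y - m y)%:E)%E.
  move=> mq; rewrite -esumD//; last by move=> z _; rewrite lee_fin subr_ge0.
  by apply: eq_esum => z _; rewrite -EFinD [m z + _]addrC subrK.
have mfin : (\esum_(y in setT) (m y)%:E)%E \is a fin_num.
  rewrite ge0_fin_numE ?esum_ge0//.
  apply: (@le_lt_trans _ _ 1%E); last exact: ltry.
  by rewrite -pi1_sum; apply: le_esum => y _; rewrite lee_fin.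
have eqmass : (\esum_(y in setT) (pi1 y - m y)%:E =
    \esum_(y in setT) (pi2 y - m y)%:E)%E.
  have := massD _ m1; rewrite pi1_sum -pi2_sum (massD _ m2).
  rewrite addeC [RHS]addeC.
  move=> /(congr1 (fun z => z - \esum_(y in setT) (m y)%:E)%E).
  by rewrite !addeK.
(* If [pi2 x < pi1 x], then [pi1 - m] charges [x], hence [o]; having the same mass, [pi2 - m]
   charges some [y], hence [o] too. But [m o] is one of [pi1 o] and [pi2 o]. *)
rewrite leNgt; apply/negP => lt21.
have d1 y : 0 <= pi1 y - m y by rewrite subr_ge0.
have d2 y : 0 <= pi2 y - m y by rewrite subr_ge0.
have o1 : 0 < pi1 o - m o.
  apply: (@invariant_gt0 (fun y => pi1 y - m y) x) => //.
    exact: diffI.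
  by rewrite subr_gt0 /m gt_min lt21 orbT.
have [y _] : exists2 y, setT y & (0 < (pi2 y - m y)%:E)%E.
  apply: esum_gt0P => [y|]; first by rewrite lee_fin.
  rewrite -eqmass; apply: lt_le_trans (@le_esum_term _ _ setT _ o I _).
    by rewrite lte_fin.
  by move=> y; rewrite lee_fin.
rewrite lte_fin => y2.
have o2 : 0 < pi2 o - m o.
  by apply: (@invariant_gt0 (fun y => pi2 y - m y) y) => //; exact: diffI.
move: o1 o2; rewrite !subr_gt0 /m !gt_min !ltxx/= orbF => h1 h2.
by have := lt_trans h1 h2; rewrite ltxx.
Qed.

(* Hitting probabilities are the least nonnegative superharmonic function. *)
Lemma kernel_pow_series_le B (D h : S -> K) :
  (forall x, 0 <= D x) -> (forall x, 0 <= h x) ->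
  (forall x, B x ->
    (\esum_(z in B) (p x z * h z)%:E + (D x)%:E <= (h x)%:E)%E) ->
  forall x, B x ->
  (\esum_(y in B) ((\sum_(0 <= k <oo) kernel_pow p B k x y) * (D y)%:E)
     <= (h x)%:E)%E.
Proof.
move=> D0 h0 hsup x Bx.
have t0 k z y : (0 <= kernel_pow p B k z y * (D y)%:E)%E.
  by rewrite mule_ge0 ?kernel_pow_ge0// lee_fin.
have -> : (\esum_(y in B) ((\sum_(0 <= k <oo) kernel_pow p B k x y) * (D y)%:E)
   = \sum_(0 <= k <oo) \esum_(y in B) (kernel_pow p B k x y * (D y)%:E))%E.
  rewrite nneseries_esumT; last by move=> k; apply: esum_ge0.
  rewrite -exchange_esum//; apply: eq_esum => y _.
  rewrite muleC -nneseriesZl; last by move=> k _; exact: kernel_pow_ge0.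
  rewrite -nneseries_esumT//; apply: eq_eseriesr => k _; exact: muleC.
apply: lime_le; first by apply: is_cvg_nneseries => k _ _; exact: esum_ge0.
(* Induction on the number of terms: [k = 0] contributes [D x], and the later terms, split at the
   first step [z], at most the sum of [p x z * h z]. *)
apply: nearW => n; elim: n x Bx => [|n IH] x Bx.
  by rewrite big_nil lee_fin.
rewrite big_nat_recl//=; apply: le_trans (hsup x Bx).
rewrite addeC; apply: leeD.
  rewrite (@esum_eq1 _ _ _ _ x)// ?eqxx ?mul1e ?lee_fin//.
  by move=> y yx; rewrite eq_sym (negbTE yx) mul0e.
have -> : (\sum_(0 <= i < n)
   \esum_(y in B)
     (\esum_(z in B) (p x z)%:E * kernel_pow p B i z y) * (D y)%:E =
   \esum_(z in B) ((p x z)%:E *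
     \sum_(0 <= i < n) \esum_(y in B) (kernel_pow p B i z y * (D y)%:E)))%E.
  under [RHS]eq_esum => z _.
    rewrite ge0_sume_distrr; last by move=> i _; apply: esum_ge0.
    over.
  rewrite esum_sum; last first.
    by move=> z i _ _; rewrite mule_ge0 ?lee_fin ?esum_ge0.
  apply: eq_bigr => i _.
  under [RHS]eq_esum do rewrite -esumZl//.
  rewrite exchange_esum; last by move=> z y; rewrite mule_ge0 ?lee_fin.
  apply: eq_esum => y _; rewrite muleC -esumZl//; last first.
    by move=> z; rewrite mule_ge0 ?lee_fin ?kernel_pow_ge0.
  by apply: eq_esum => z _; rewrite muleC muleA.
apply: le_esum => z Bz; rewrite EFinM; apply: lee_wpmul2l.
  by rewrite lee_fin.
exact: IH.
Qed.

End chain.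

(** * Substochastic matrices and the matrices zeta *)

Lemma nonneg_mxM (K : realType) (m n k : nat) (A : 'M[K]_(m, n))
    (B : 'M[K]_(n, k)) :
  nonneg_mx A -> nonneg_mx B -> nonneg_mx (A *m B).
Proof.
by move=> A0 B0 i j; rewrite mxE sumr_ge0// => l _; rewrite mulr_ge0.
Qed.

Lemma mulmx_onesE (K : realType) (m d : nat) (A : 'M[K]_(m, d)) i :
  (A *m ones) i ord0 = \sum_j A i j.
Proof. by rewrite mxE; apply: eq_bigr => j _; rewrite mxE mulr1. Qed.

Section substochastic_inverse.
Context {K : realType} {d : nat} (B : 'M[K]_d).
Hypotheses (B_ge0 : nonneg_mx B) (B_lt1 : forall i, (B *m ones) i ord0 < 1).

(* Minimum principle: evaluate at an index where [x] is minimal. *)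
Lemma subid_mx_minimum (x : 'cV[K]_d) :
  (forall i, 0 <= ((1%:M - B) *m x) i ord0) -> forall i, 0 <= x i ord0.
Proof.
move=> hx i0.
have [i _ xmin] := @arg_minP _ _ _ i0 xpredT (fun i => x i ord0) isT.
apply: le_trans (xmin i0 isT); rewrite leNgt; apply/negP => xi0.
have := hx i; rewrite mulmxBl mul1mx mxE [X in _ + X]mxE subr_ge0 leNgt.
move/negP; apply.
(* As [x i < 0] and row [i] of [B] sums to less than 1, minimality gives
   [(B x) i >= x i * (B 1) i > x i]. *)
have : x i ord0 * 1 < x i ord0 * (B *m ones) i ord0 by rewrite ltr_nM2l.
rewrite mulr1 => /lt_le_trans; apply.
rewrite mulmx_onesE mulr_sumr mxE; apply: ler_sum => j _.
by rewrite mulrC ler_wpM2l// xmin.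
Qed.

(** The minimum principle, applied to a kernel vector and to its opposite, forces it to vanish. The
    transpose turns the left kernel vector of [det0P] into a column. *)
Lemma subid_mx_unit : 1%:M - B \in unitmx.
Proof.
rewrite -unitmx_tr unitmxE unitfE; apply/negP => /det0P[v v0 vB].
have xB : (1%:M - B) *m v^T = 0 by rewrite -[LHS]trmxK trmx_mul trmxK vB trmx0.
move/negP: v0; apply; apply/eqP/rowP => i; rewrite [RHS]mxE.
apply/eqP; rewrite eq_le; apply/andP; split.
  have := @subid_mx_minimum (- v^T) _ i; rewrite !mxE oppr_ge0; apply => j.
  by rewrite mulmxN xB oppr0 mxE.
by have := @subid_mx_minimum v^T _ i; rewrite !mxE; apply => j; rewrite xB mxE.
Qed.

(** [1 - B] maps each column of its inverse to a column of the identity, so the minimum principle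
    applies. *)
Lemma subid_mx_inv_ge0 : nonneg_mx (invmx (1%:M - B)).
Proof.
move=> i j; have := @subid_mx_minimum (col j (invmx (1%:M - B))) _ i.
rewrite mxE; apply => k.
by rewrite colE mulmxA mulmxV ?subid_mx_unit// mul1mx mxE ler0n.
Qed.

End substochastic_inverse.

Lemma cvg_mx_entry (K : realType) (m n : nat) (F : nat -> 'M[K]_(m, n)) i j :
  cvg (F a @[a --> \oo]) ->
  F a i j @[a --> \oo] --> (lim (F a @[a --> \oo]) : 'M[K]_(m, n)) i j.
Proof. move=> cF.
exact: (cvg_comp _ _ cF (@coord_continuous K m n i j _)). Qed.

Lemma cvg_mulmx_entry (K : realType) (m n k : nat) (F : nat -> 'M[K]_(m, n))
    (G : nat -> 'M[K]_(n, k)) (A : 'M[K]_(m, n)) (B : 'M[K]_(n, k)) :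
  (forall i j, F a i j @[a --> \oo] --> A i j) ->
  (forall i j, G a i j @[a --> \oo] --> B i j) ->
  forall i j, (F a *m G a) i j @[a --> \oo] --> (A *m B) i j.
Proof.
move=> FA GB i j; under eq_cvg do rewrite mxE.
by rewrite mxE; apply: cvg_big => [|l _]; [exact: add_continuous|exact: cvgM].
Qed.

(** * The resolvents, and the limits [zeta n] with their fixed-point equation *)

Section blocks.
Context {K : realType} {d : nat} (P Q R : nat -> 'M[K]_d) (rho : 'M[K]_d).
Hypotheses (hPQR : strip_blocks P Q R) (hC1 : cond_C1 P Q R).
Hypothesis hrho : stochastic_mx rho.

Lemma strip_blocks_ge0 n : (0 < n)%N ->
  [/\ nonneg_mx (P n), nonneg_mx (Q n) & nonneg_mx (R n)].
Proof. by case: hPQR => _ _ h _; exact: h. Qed.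

Lemma row_sum_le_norm (A : 'M[K]_d) i : \sum_j A i j <= row_sum_norm A.
Proof.
apply: le_trans (le_bigmax 0 (fun i => \sum_j `|A i j|) i).
by apply: ler_sum => j _; exact: ler_norm.
Qed.

Section step.
Variables (n : nat) (Z : 'M[K]_d).
Hypotheses (n_gt0 : (0 < n)%N) (hZ : stochastic_mx Z).

Let B := P n *m Z + R n.

Let subE : 1%:M - P n *m Z - R n = 1%:M - B.
Proof. by rewrite /B opprD addrA. Qed.

Let B_ge0 : nonneg_mx B.
Proof.
have [P0 _ R0] := strip_blocks_ge0 n_gt0.
by move=> i j; rewrite mxE addr_ge0// nonneg_mxM//; case: hZ.
Qed.

Let B_ones : B *m ones = (P n + R n) *m ones.
Proof. by rewrite !mulmxDl -mulmxA; case: hZ => _ ->. Qed.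

(** Since [Z] is stochastic, [B] has the row sums of [R n + P n], which [C_1] bounds below 1. *)
Let B_lt1 i : (B *m ones) i ord0 < 1.
Proof.
rewrite B_ones addrC mulmx_onesE; apply: le_lt_trans (row_sum_le_norm _ i) _.
by case: (hC1 n_gt0).
Qed.

Lemma resolvent_unit : 1%:M - P n *m Z - R n \in unitmx.
Proof. by rewrite subE; exact: subid_mx_unit. Qed.

Lemma resolvent_ge0 : nonneg_mx (resolvent P R n Z).
Proof. by rewrite /resolvent subE; exact: subid_mx_inv_ge0. Qed.

(** For the row sums, [(I - P_n Z - R_n) 1 = 1 - (P_n + R_n) 1 = Q_n 1]. *)
Lemma resolventM_stochastic : stochastic_mx (resolvent P R n Z *m Q n).
Proof.
split.
  by apply: nonneg_mxM resolvent_ge0 _; case: (strip_blocks_ge0 n_gt0).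
rewrite -mulmxA; apply: (canLR (mulKmx resolvent_unit)).
rewrite subE mulmxBl B_ones mul1mx; apply/eqP; rewrite eq_sym subr_eq.
rewrite -mulmxDl addrC -[_ + Q n]addrA [_ + Q n]addrC addrA.
by case: hPQR => _ _ _ ->.
Qed.

End step.

Lemma zeta_rec_stochastic k n : (0 < n)%N ->
  stochastic_mx (zeta_rec P Q R rho k n).
Proof.
elim: k n => [//|k IH] n n0 /=.
by apply: resolventM_stochastic => //; exact: IH.
Qed.

Hypothesis hzeta : forall n, (0 < n)%N ->
  cvg (zeta_cut P Q R rho n a @[a --> \oo]).

Local Notation zeta := (zeta P Q R rho).
Local Notation u_tilde := (u_tilde P Q R rho).

Lemma zeta_cut_cvg n (n0 : (0 < n)%N) i j :
  zeta_cut P Q R rho n a i j @[a --> \oo] --> zeta n i j.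
Proof. by apply: cvg_mx_entry; exact: hzeta. Qed.

(** Nonnegativity and unit row sums pass to the limit. They hold for every [a], since the truncated
    difference [a - n] gives [rho] when [a <= n]. *)
Lemma zeta_stochastic n : (0 < n)%N -> stochastic_mx (zeta n).
Proof.
move=> n0; split.
  move=> i j; have h := @zeta_cut_cvg n n0 i j; rewrite -(cvg_lim _ h)//.
  apply: limr_ge; first exact: cvgP h.
  by apply: nearW => a; case: (zeta_rec_stochastic (a - n) n0).
apply/matrixP => i j; rewrite [j]ord1 [RHS]mxE.
have cst_ones k l : (fun=> ones k l) a @[a --> \oo] --> (ones : 'cV[K]_d) k l.
  exact: cvg_cst.
have := @cvg_mulmx_entry _ _ _ _ _ (fun=> ones) _ _
  (fun k l => @zeta_cut_cvg n n0 k l) cst_ones i ord0.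
move/cvg_lim => <-//; apply: lim_near_cst => //; apply: nearW => a.
by case: (zeta_rec_stochastic (a - n) n0) => _ ->; rewrite mxE.
Qed.

Lemma u_tilde_unit n : (0 < n)%N ->
  1%:M - P n *m zeta n.+1 - R n \in unitmx.
Proof. by move=> n0; apply: resolvent_unit => //; exact: zeta_stochastic. Qed.

Lemma u_tilde_ge0 n : (0 < n)%N -> nonneg_mx (u_tilde n).
Proof. by move=> n0; apply: resolvent_ge0 => //; exact: zeta_stochastic. Qed.

(** The limit is taken in [(I - P_n zeta_{n+1,a} - R_n) zeta_{n,a} = Q_n], valid for [a > n]; in
    this multiplied form no continuity of the inverse enters. *)
Lemma zetaE n : (0 < n)%N -> zeta n = u_tilde n *m Q n.
Proof.
move=> n0; apply: (canRL (mulKmx (u_tilde_unit n0))).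
pose M a := 1%:M - P n *m zeta_cut P Q R rho n.+1 a - R n.
have cM i j : M a i j @[a --> \oo] --> (1%:M - P n *m zeta n.+1 - R n) i j.
  under eq_cvg do rewrite /M mxE [X in X + _]mxE [X in _ + X + _]mxE.
  rewrite mxE [X in X + _]mxE [X in _ + X + _]mxE.
  apply: cvgD; last exact: cvg_cst.
  apply: cvgB; first exact: cvg_cst.
  apply: (cvg_mulmx_entry (F := fun=> P n)) => k l; first exact: cvg_cst.
  exact: zeta_cut_cvg.
apply/matrixP => i j.
have /cvg_lim <-// := @cvg_mulmx_entry _ _ _ _ _ _ _ _ cM
  (fun k l => @zeta_cut_cvg n n0 k l) i j.
apply: lim_near_cst => //; near=> a.
have na : (n < a)%N by near: a; exact: nbhs_infty_gt.
(* As [a > n], the recursion unfolds once, and [(a - n).-1 = a - n.+1] is the depth that [zeta_cut]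
   has at [n.+1]. *)
congr (_ i j); rewrite /M /zeta_cut -[(a - n)%N]prednK ?subn_gt0//=.
rewrite -subnS /resolvent mulKVmx//; apply: resolvent_unit => //.
exact: zeta_rec_stochastic.
Unshelve. all: by end_near. Qed.

Lemma zeta_balance n : (0 < n)%N ->
  zeta n = (P n *m zeta n.+1 + R n) *m zeta n + Q n.
Proof.
move=> n0; have := mulKVmx (u_tilde_unit n0) (Q n).
rewrite -[invmx _]/(u_tilde n) -zetaE// => <-.
by rewrite -addrA -opprD mulmxBl mul1mx addrC subrK.
Qed.

End blocks.

(** * The chain on the half-strip *)

Lemma esum_finType (K : realType) (I : finType) (a : I -> \bar K) :
  (forall i, 0 <= a i)%E -> (\esum_(i in setT) a i = \sum_i a i)%E.
Proof.
move=> a0.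
transitivity (\esum_(i in setT) \sum_j (if i == j then a j else 0))%E.
  apply: eq_esum => i _; rewrite (bigD1 i)//= eqxx big1 ?adde0// => j.
  by rewrite eq_sym => /negbTE ->.
rewrite esum_sum; last by move=> i j _ _; case: ifP.
apply: eq_bigr => j _; rewrite (@esum_eq1 _ _ _ _ j) ?eqxx//.
by move=> i /negbTE ->.
Qed.

Section strip_sums.
Context {K : realType} {d : nat}.

Lemma esum_layers (f : nat * 'I_d -> \bar K) : (forall x, 0 <= f x)%E ->
  (\esum_(x in setT) f x = \sum_(0 <= n <oo) \sum_(i < d) f (n, i))%E.
Proof.
move=> f0; rewrite nneseries_esumT; last by move=> n; exact: sume_ge0.
under [RHS]eq_esum do rewrite -esum_finType//.
rewrite (esum_esum (a := fun n i => f (n, i)))//.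
rewrite (_ : _ `*`` _ = setT); last by apply/seteqP; split.
by apply: eq_esum => -[].
Qed.

Lemma esum_layers_lt (f : nat * 'I_d -> \bar K) N : (forall x, 0 <= f x)%E ->
  (forall n i, (N <= n)%N -> f (n, i) = 0)%E ->
  (\esum_(x in setT) f x = \sum_(0 <= n < N) \sum_(i < d) f (n, i))%E.
Proof.
move=> f0 fN; rewrite esum_layers// (nneseries_split 0 N); last first.
  by move=> k _; exact: sume_ge0.
rewrite add0n eseries0 ?adde0// => n Nn _.
by rewrite big1// => i _; exact: fN.
Qed.

(** [m] is the lowest of the three layers: those linked by one step to layer [m.+1]. *)
Lemma esum_three_layers (f : nat * 'I_d -> \bar K) m : (forall x, 0 <= f x)%E ->
  (forall n i, (n < m)%N || (m.+2 < n)%N -> f (n, i) = 0)%E ->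
  (\esum_(x in setT) f x = \sum_(i < d) f (m, i) + \sum_(i < d) f (m.+1, i) +
     \sum_(i < d) f (m.+2, i))%E.
Proof.
move=> f0 fz; rewrite (esum_layers_lt (N := m.+3))//; last first.
  by move=> n i mn; apply: fz; rewrite mn orbT.
rewrite big_nat_recr// big_nat_recr// big_nat_recr//= big1_seq ?add0e// => n.
rewrite mem_index_iota => /= nm; rewrite big1// => i _.
by rewrite fz// nm.
Qed.

Variables P Q R : nat -> 'M[K]_d.
Local Notation p := (strip_trans P Q R).

Lemma strip_trans_up m i j : p (m, i) (m.+1, j) = P m i j.
Proof. by rewrite /strip_trans eqxx. Qed.

Lemma strip_trans_stay m i j : p (m.+1, i) (m.+1, j) = R m.+1 i j.
Proof. by rewrite /strip_trans ltn_eqF// eqxx. Qed.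

Lemma strip_trans_down m i j : p (m.+1, i) (m, j) = Q m.+1 i j.
Proof.
by rewrite /strip_trans (ltn_eqF (leqW (ltnSn m))) (ltn_eqF (ltnSn m)) eqxx.
Qed.

Lemma strip_trans_far m n i j :
  n != m.+1 -> (m == 0%N) || ((n != m) && (n.+1 != m)) -> p (m, i) (n, j) = 0.
Proof.
rewrite /strip_trans => /negbTE ->.
by case: eqVneq => //= _ /andP[/negbTE -> /negbTE ->].
Qed.

Hypothesis hPQR : strip_blocks P Q R.

Lemma strip_trans_ge0 x y : 0 <= p x y.
Proof.
case: hPQR => P0 _ h _; case: x y => [[|m] i] [n j]; rewrite /strip_trans.
  by case: ifP.
by have [] := h m.+1 isT; do 3 case: ifP => //.
Qed.

(** Functions are given by one column per layer and weights by one row per layer, so that the action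
    of the kernel becomes a block product, here and in the next three lemmas. *)
Lemma strip_row0 (h : nat -> 'cV[K]_d) i : (forall n, nonneg_mx (h n)) ->
  (\esum_(z in setT) (p (0%N, i) z * h z.1 z.2 ord0)%:E =
   ((P 0 *m h 1%N) i ord0)%:E)%E.
Proof.
move=> h0; rewrite (@esum_layers_lt _ 2%N).
- rewrite 2?big_ltn// big_geq// adde0 big1 ?add0e => [|j _]; last first.
    by rewrite mul0r.
  by rewrite sumEFin; congr EFin; rewrite mxE.
- by move=> z; rewrite lee_fin mulr_ge0 ?strip_trans_ge0 ?h0.
- by move=> n j n2; rewrite strip_trans_far ?mul0r//; case: n n2 => [|[]].
Qed.

Lemma strip_rowS (h : nat -> 'cV[K]_d) m i : (forall n, nonneg_mx (h n)) ->
  (\esum_(z in setT) (p (m.+1, i) z * h z.1 z.2 ord0)%:E =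
   ((P m.+1 *m h m.+2 + R m.+1 *m h m.+1 + Q m.+1 *m h m) i ord0)%:E)%E.
Proof.
move=> h0; rewrite (@esum_three_layers _ m).
- rewrite [P _ *m _ + _ + _]addrC addrA [_ + P _ *m _ + _]addrAC.
  rewrite !sumEFin -!EFinD; congr EFin; rewrite !mxE.
  congr (_ + _ + _); apply: eq_bigr => j _.
  + by rewrite -strip_trans_down.
  + by rewrite -strip_trans_stay.
  + by rewrite -strip_trans_up.
- by move=> z; rewrite lee_fin mulr_ge0 ?strip_trans_ge0 ?h0.
- by move=> n j nm; rewrite strip_trans_far ?mul0r//; lia.
Qed.

Lemma strip_col0 (g : nat -> 'rV[K]_d) j : (forall n, nonneg_mx (g n)) ->
  (\esum_(z in setT) (g z.1 ord0 z.2 * p z (0%N, j))%:E =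
   ((g 1%N *m Q 1) ord0 j)%:E)%E.
Proof.
move=> g0; rewrite (@esum_layers_lt _ 2%N).
- rewrite 2?big_ltn// big_geq// adde0 big1 ?add0e => [|i _]; last first.
    by rewrite mulr0.
  by rewrite sumEFin; congr EFin; rewrite mxE.
- by move=> z; rewrite lee_fin mulr_ge0 ?strip_trans_ge0 ?g0.
- by move=> n i n2; rewrite strip_trans_far ?mulr0//; case: n n2 => [|[]].
Qed.

Lemma strip_colS (g : nat -> 'rV[K]_d) m j : (forall n, nonneg_mx (g n)) ->
  (\esum_(z in setT) (g z.1 ord0 z.2 * p z (m.+1, j))%:E =
   ((g m *m P m + g m.+1 *m R m.+1 + g m.+2 *m Q m.+2) ord0 j)%:E)%E.
Proof.
move=> g0; rewrite (@esum_three_layers _ m).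
- rewrite !sumEFin -!EFinD; congr EFin; rewrite !mxE.
  congr (_ + _ + _); apply: eq_bigr => i _.
  + by rewrite -strip_trans_up.
  + by rewrite -strip_trans_stay.
  + by rewrite -strip_trans_down.
- by move=> z; rewrite lee_fin mulr_ge0 ?strip_trans_ge0 ?g0.
- by move=> n i nm; rewrite strip_trans_far ?mulr0//; lia.
Qed.

Lemma ones_ge0 : nonneg_mx (ones : 'cV[K]_d).
Proof. by move=> i j; rewrite mxE. Qed.

Lemma strip_trans_sum1 x : (\esum_(y in setT) (p x y)%:E = 1)%E.
Proof.
transitivity (\esum_(y in setT) (p x y * (ones : 'cV[K]_d) y.2 ord0)%:E)%E.
  by apply: eq_esum => y _; rewrite mxE mulr1.
case: x => [[|m] i].
  rewrite (strip_row0 (h := fun=> ones)) => [|n]; last exact: ones_ge0.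
  by case: hPQR => _ -> _ _; rewrite mxE.
rewrite (strip_rowS (h := fun=> ones)) => [|n]; last exact: ones_ge0.
rewrite -!mulmxDl -addrA [R _ + _]addrC addrA.
by case: hPQR => _ _ _ ->//; rewrite mxE.
Qed.

(** By [C_1] the rows of [R_n + P_n] sum to less than 1, so each row of [Q_n] has a positive entry
    and the chain can descend to layer 0, where [C_3] takes over. *)
Lemma strip_accessible i0 : cond_C1 P Q R -> cond_C3 P Q R ->
  forall x, accessible p x (0%N, i0).
Proof.
move=> C1 C3 [n i]; elim: n i => [|n IH] i; first by case: (C3 i i0).
have [P0 Q0 R0] := strip_blocks_ge0 hPQR (ltn0Sn n).
have : 0 < \sum_j Q n.+1 i j.
  have /(congr1 (fun A : 'cV_d => A i ord0)) :
      (P n.+1 + Q n.+1 + R n.+1) *m ones = ones.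
    by case: hPQR => _ _ _ ->.
  rewrite -addrA [Q _ + _]addrC addrA mulmxDl mxE 2!mulmx_onesE mxE => E.
  have [+ _] := C1 n.+1 isT; move/(le_lt_trans (row_sum_le_norm _ i)).
  by rewrite [R _ + _]addrC -E -subr_gt0 [X in X - _]addrC addrK.
rewrite lt_neqAle eq_sym psumr_neq0//; case/andP => /hasP[j _ /= Qij] _.
apply: (accessible_step strip_trans_ge0) (IH j).
by rewrite strip_trans_down.
Qed.

End strip_sums.

(** * The stationary weights *)

(** Registering [mulmx] as a monoid law lets [big_nat_recr] split off the last factor of
    [A_prod]. *)
HB.instance Definition _ (K : realType) (d : nat) :=
  Monoid.isLaw.Build 'M[K]_d 1%:M (@mulmx K d d d)
    (@mulmxA K d d d d) (@mul1mx K d d) (@mulmx1 K d d).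

Lemma mulmx_colE (K : realType) (m n k : nat) (A : 'M[K]_(m, n))
    (B : 'M[K]_(n, k)) i j : (A *m col j B) i ord0 = (A *m B) i j.
Proof. by rewrite !mxE; apply: eq_bigr => l _; rewrite mxE. Qed.

Lemma le_rowsum_eq (K : realType) (d : nat) (a b : 'rV[K]_d) :
  (forall j, a ord0 j <= b ord0 j) ->
  \sum_j a ord0 j = \sum_j b ord0 j -> a = b.
Proof.
move=> ab sab; have : \sum_j (b ord0 j - a ord0 j) = 0.
  by rewrite sumrB sab subrr.
move=> /psumr_eq0P h; apply/rowP => j; apply/eqP; rewrite eq_sym -subr_eq0.
by rewrite h// => k _; rewrite subr_ge0.
Qed.

Lemma eq_eseries_from (K : realType) (f g : nat -> \bar K) N :
  (forall k, (N <= k)%N -> f k = g k) ->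
  (\sum_(N <= k <oo) f k = \sum_(N <= k <oo) g k)%E.
Proof.
move=> fg; apply/congr_lim/funext => n.
by apply: eq_big_nat => k /andP[Nk _]; exact: fg.
Qed.

Section stationary.
Context {K : realType} {d : nat} (P Q R : nat -> 'M[K]_d) (rho : 'M[K]_d).
Hypotheses (hPQR : strip_blocks P Q R) (hC1 : cond_C1 P Q R).
Hypothesis hrho : stochastic_mx rho.
Hypothesis hzeta : forall n, (0 < n)%N ->
  cvg (zeta_cut P Q R rho n a @[a --> \oo]).

Local Notation p := (strip_trans P Q R).
Local Notation zeta := (zeta P Q R rho).
Local Notation u_tilde := (u_tilde P Q R rho).
Local Notation A_minus := (A_minus P Q R rho).
Local Notation A_prod := (A_prod P Q R rho).
Local Notation u_minus := (u_minus P Q R rho).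

(* [zeta_n ... zeta_1]: a candidate for the distribution of the first visit to
   layer 0, as a function of the starting state. *)
Fixpoint zeta_prod n : 'M[K]_d :=
  if n is n'.+1 then zeta n *m zeta_prod n' else 1%:M.

Lemma zeta_prod_ge0 n : nonneg_mx (zeta_prod n).
Proof.
elim: n => [|n IH] /=; first by move=> i j; rewrite mxE ler0n.
by apply: nonneg_mxM IH; case: (zeta_stochastic hPQR hC1 hrho hzeta (ltn0Sn n)).
Qed.

(** This is [zeta_balance] at [n.+1] multiplied on the right by [zeta_prod n]. *)
Lemma zeta_prod_harmonic n :
  P n.+1 *m zeta_prod n.+2 + R n.+1 *m zeta_prod n.+1 + Q n.+1 *m zeta_prod n =
  zeta_prod n.+1.
Proof.
rewrite /= [in RHS](zeta_balance hPQR hC1 hrho hzeta)// !mulmxDl.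
by rewrite -!mulmxA.
Qed.

Lemma P0_ge0 : nonneg_mx (P 0). Proof. by case: hPQR. Qed.

Lemma censored_le i j :
  (censored P Q R i j <= ((P 0 *m zeta 1) i j)%:E)%E.
Proof.
have p0 := strip_trans_ge0 hPQR.
pose h (x : nat * 'I_d) := zeta_prod x.1 x.2 j.
have h0 x : 0 <= h x by exact: zeta_prod_ge0.
(* Setting [h] to 0 on layer 0 turns sums over [upper_layers] into sums over all states. *)
pose hup n : 'cV[K]_d := if n is 0%N then 0 else col j (zeta_prod n).
have hup0 n : nonneg_mx (hup n).
  by case: n => [|n] k l; rewrite mxE//; exact: zeta_prod_ge0.
have upE x : (\esum_(z in upper_layers) (p x z * h z)%:E =
    \esum_(z in setT) (p x z * hup z.1 z.2 ord0)%:E)%E.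
  rewrite esum_mkcond; apply: eq_esum => -[[|n] k] _.
    by rewrite memNset// mxE mulr0.
  by rewrite mem_set// mxE.
have hsup x : upper_layers x ->
    (\esum_(z in upper_layers) (p x z * h z)%:E + (p x (0%N, j))%:E
      <= (h x)%:E)%E.
  case: x => [[|m] k] // _.
  rewrite upE (strip_rowS hPQR)// -EFinD lee_fin /h -zeta_prod_harmonic.
  have addE m1 m2 (A B : 'M[K]_(m1, m2)) a b : (A + B) a b = A a b + B a b.
    by rewrite mxE.
  (* Only the term from below is left. From layer 1 it is the exit probability [Q_1], as
     [zeta_prod 0] is the identity; from higher layers, layer 0 is out of reach in one step. *)
  rewrite !addE /hup !mulmx_colE -addrA lerD2l; case: m => [|m]; last first.
    by rewrite mulmx_colE strip_trans_far// addr0.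
  by rewrite strip_trans_down mulmx0 mxE add0r mulmx1.
rewrite /censored.
apply: (@le_trans _ _ (\esum_(x in upper_layers) (p (0%N, i) x * h x)%:E)%E).
  apply: le_esum => x xup.
  under eq_esum do rewrite -muleA.
  rewrite esumZl//; last first.
    move=> y; rewrite mule_ge0 ?lee_fin// nneseries_ge0// => k _ _.
    exact: kernel_pow_ge0.
  rewrite EFinM lee_wpmul2l ?lee_fin//.
  by apply: (@kernel_pow_series_le _ _ p p0 _ (fun y => p y (0%N, j)) h).
by rewrite upE (strip_row0 hPQR)// mulmx_colE /= mulmx1.
Qed.

Variable mu : 'rV[K]_d.
Hypothesis hmu : censored_measure P Q R mu.

Lemma mu_ge0 : nonneg_mx mu. Proof. by case: hmu. Qed.

Lemma censored_measure_fixed : mu *m P 0 *m zeta 1 = mu.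
Proof.
have [mu0 mu1 muE] := hmu; apply/esym/le_rowsum_eq => [j|].
  rewrite -lee_fin -muE -mulmxA mxE -sumEFin; apply: lee_sum => i _.
  by rewrite EFinM lee_wpmul2l ?lee_fin ?mu0// censored_le.
rewrite -!mulmx_onesE -!mulmxA.
have [_ ->] := zeta_stochastic hPQR hC1 hrho hzeta (ltn0Sn 0).
by case: hPQR => _ ->.
Qed.

(** The vectors [v_n], that is, the stationary masses before normalization. *)
Definition strip_weight n : 'rV[K]_d :=
  if n is 0%N then mu else mu *m P 0 *m A_prod n *m u_tilde n.

Lemma A_prod1 : A_prod 1 = 1%:M.
Proof. by rewrite /Defs.A_prod big_geq. Qed.

Lemma A_prodS n : A_prod n.+2 = A_prod n.+1 *m A_minus n.+1.
Proof. by rewrite /Defs.A_prod big_nat_recr. Qed.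

Lemma A_prod_ge0 n : nonneg_mx (A_prod n.+1).
Proof.
elim: n => [|n IH]; first by rewrite A_prod1 => i j; rewrite mxE ler0n.
rewrite A_prodS; apply: nonneg_mxM => //; apply: nonneg_mxM.
  exact: u_tilde_ge0.
by case: (strip_blocks_ge0 hPQR (ltn0Sn n)).
Qed.

Lemma strip_weight_ge0 n : nonneg_mx (strip_weight n).
Proof.
case: n => [|n] /=; first exact: mu_ge0.
apply: nonneg_mxM; last exact: u_tilde_ge0.
apply: nonneg_mxM; last exact: A_prod_ge0.
by apply: nonneg_mxM; [exact: mu_ge0|exact: P0_ge0].
Qed.

Lemma strip_weight_up n : strip_weight n *m P n = mu *m P 0 *m A_prod n.+1.
Proof.
case: n => [|n]; first by rewrite A_prod1 mulmx1.
by rewrite A_prodS /Defs.A_minus !mulmxA.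
Qed.

(** The flow down from layer [n+2] is [v_{n+1} P_{n+1} zeta_{n+2}], so the claim reads [v_{n+1} (I -
    P_{n+1} zeta_{n+2} - R_{n+1}) = v_n P_n]. *)
Lemma strip_weight_balance n :
  strip_weight n *m P n + strip_weight n.+1 *m R n.+1 +
    strip_weight n.+2 *m Q n.+2 = strip_weight n.+1.
Proof.
have -> : strip_weight n.+2 *m Q n.+2 =
    strip_weight n.+1 *m P n.+1 *m zeta n.+2.
  rewrite strip_weight_up (zetaE hPQR hC1 hrho hzeta)//=.
  by rewrite -!mulmxA.
rewrite strip_weight_up.
have := mulmxKV (u_tilde_unit hPQR hC1 hrho hzeta (ltn0Sn n))
  (mu *m P 0 *m A_prod n.+1).
rewrite -[_ *m invmx _]/(strip_weight n.+1) => {1}<-.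
by rewrite !mulmxBr mulmx1 mulmxA subrK subrK.
Qed.

Lemma strip_weight_invariant : invariant_weight p
  (fun x => strip_weight x.1 ord0 x.2).
Proof.
move=> [[|n] j].
  rewrite (strip_col0 hPQR) //; last exact: strip_weight_ge0.
  rewrite /= -[in RHS]censored_measure_fixed (zetaE hPQR hC1 hrho hzeta)//.
  by rewrite A_prod1 mulmx1 !mulmxA.
rewrite (strip_colS hPQR); last exact: strip_weight_ge0.
by rewrite strip_weight_balance.
Qed.

Lemma A_series_term_ge0 n i : 0 <= (A_prod n.+1 *m u_minus n.+1) i ord0.
Proof.
apply: nonneg_mxM; first exact: A_prod_ge0.
by apply: nonneg_mxM; [exact: u_tilde_ge0|exact: ones_ge0].
Qed.

Lemma A_series_ge0 i : (0 <= A_series P Q R rho i)%E.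
Proof.
by apply: nneseries_ge0 => -[//|k] _ _; rewrite lee_fin A_series_term_ge0.
Qed.

(** Since [u_k = u~_k 1], layer [k > 0] has mass [mu P_0 A_1 ... A_{k-1} u_k]; nonnegativity allows
    exchanging the series with the finite sum over the entries of [mu P_0]. *)
Lemma strip_weight_mass :
  (\esum_(x in setT) (strip_weight x.1 ord0 x.2)%:E =
   normalizer P Q R rho mu)%E.
Proof.
have w0 n i : (0 <= (strip_weight n ord0 i)%:E)%E.
  by rewrite lee_fin strip_weight_ge0.
rewrite esum_layers => [|x]; last exact: w0.
rewrite (nneseries_split 0%N 1%N); last by move=> k _; exact: sume_ge0.
rewrite add0n big_nat1 /normalizer addeC; congr (_ + _)%E; last first.
  by rewrite sumEFin mulmx_onesE.
rewrite /row_pairing /A_series.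
have a0 i : 0 <= (mu *m P 0) ord0 i.
  by apply: nonneg_mxM; [exact: mu_ge0|exact: P0_ge0].
have E k : (0 < k)%N -> (\sum_i (strip_weight k ord0 i)%:E =
    \sum_i ((mu *m P 0) ord0 i)%:E * ((A_prod k *m u_minus k) i ord0)%:E)%E.
  case: k => // k _; rewrite sumEFin -mulmx_onesE /= -mulmxA.
  rewrite -[u_tilde _ *m ones]/(u_minus k.+1) -mulmxA mxE -sumEFin.
  by apply: eq_bigr => i _; rewrite EFinM.
(* The library lemmas on series want nonnegative terms at index 0 as well. *)
pose t k i := if k is 0%N then 0 else (A_prod k *m u_minus k) i ord0.
have t0 k i : 0 <= t k i by case: k => // k; exact: A_series_term_ge0.
under [RHS]eq_bigr => i _.
  rewrite (@eq_eseries_from _ _ (fun k => (t k i)%:E) 1%N); last by case.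
  rewrite -nneseriesZl; last by move=> k _; rewrite lee_fin.
  over.
rewrite -nneseries_sum; last by move=> i k _; rewrite mule_ge0 ?lee_fin.
by apply: eq_eseries_from => -[//|k] _; rewrite E.
Qed.

Lemma normalizer_ge1 : (1 <= normalizer P Q R rho mu)%E.
Proof.
have [mu0 mu1 _] := hmu.
rewrite /normalizer mulmx_onesE mu1 leeDr// sume_ge0// => i _.
rewrite mule_ge0 ?A_series_ge0// lee_fin.
by apply: nonneg_mxM; [exact: mu_ge0|exact: P0_ge0].
Qed.

(** The entries of [mu] are at most 1, so [mu] is dominated by the row of ones, for which the same
    expression is [varrho1]. *)
Lemma normalizer_le_varrho1 :
  (normalizer P Q R rho mu <= varrho1 P Q R rho)%E.
Proof.
have [mu0 mu1 _] := hmu.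
have mu_le1 i : mu ord0 i <= 1.
  by rewrite -mu1 (bigD1 i)//= lerDl sumr_ge0.
apply: leeD.
  apply: lee_sum => i _; rewrite lee_wpmul2r ?A_series_ge0// lee_fin !mxE.
  by apply: ler_sum => k _; rewrite !mxE ler_wpM2r// P0_ge0.
rewrite lee_fin mulmx_onesE; apply: (@le_trans _ _ (\sum_(i < d) 1)).
  exact: ler_sum.
by rewrite sumr_const card_ord.
Qed.

End stationary.

(** * Normalization of the weights, and uniqueness *)

Theorem theorem1p4 (K : realType) (d : nat) (hd : (0 < d)%N)
  (P Q R : nat -> 'M[K]_d) (hPQR : strip_blocks P Q R)
  (hC1 : cond_C1 P Q R) (hC2 : cond_C2 P Q) (hC3 : cond_C3 P Q R)
  (rho : 'M[K]_d) (hrho : stochastic_mx rho)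
  (hzeta : forall n, (0 < n)%N ->
     cvg (zeta_cut P Q R rho n a @[a --> \oo]))
  (hvarrho : (varrho1 P Q R rho < +oo)%E)
  (mu : 'rV[K]_d) (hmu : censored_measure P Q R mu) :
  (exists nu : nat -> 'rV[K]_d,
     [/\ unique (strip_stationary P Q R) nu,
         forall n, (0 < n)%N ->
           nu n = (fine (normalizer P Q R rho mu))^-1 *:
             (mu *m P 0%N *m A_prod P Q R rho n *m u_tilde P Q R rho n) &
         nu 0%N = (fine (normalizer P Q R rho mu))^-1 *: mu]) /\
  (normalizer P Q R rho mu <= varrho1 P Q R rho < +oo)%E.
Proof.
have le_varrho := normalizer_le_varrho1 hPQR hC1 hrho hzeta hmu.
split; last by rewrite le_varrho.
have N1 := normalizer_ge1 hPQR hC1 hrho hzeta hmu.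
(* Being finite and at least 1, the normalizer equals its real part [c], and [c] is invertible. *)
have Nfin : normalizer P Q R rho mu \is a fin_num.
  rewrite ge0_fin_numE; first exact: le_lt_trans hvarrho.
  exact: le_trans N1.
set c := fine (normalizer P Q R rho mu).
have NE : normalizer P Q R rho mu = c%:E by rewrite fineK.
have c_gt0 : 0 < c by rewrite -lte_fin -NE; exact: lt_le_trans N1.
have w0 := strip_weight_ge0 hPQR hC1 hrho hzeta hmu.
exists (fun n => c^-1 *: strip_weight P Q R rho mu n); split=> //; last by case.
have nu_stat : strip_stationary P Q R
    (fun n => c^-1 *: strip_weight P Q R rho mu n).
  have ci0 : 0 <= c^-1 by rewrite invr_ge0 ltW.
  split=> [x||y].
  - by rewrite mxE mulr_ge0// w0.
  - under eq_esum do rewrite mxE EFinM.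
    rewrite esumZl//; last by move=> x; rewrite lee_fin w0.
    by rewrite strip_weight_mass// NE -EFinM mulVf// gt_eqF.
  - under eq_esum do rewrite mxE -mulrA EFinM.
    rewrite esumZl//; last first.
      by move=> x; rewrite lee_fin mulr_ge0 ?w0// (strip_trans_ge0 hPQR).
    by rewrite strip_weight_invariant// mxE EFinM.
split=> // nu' nu'_stat.
have p0 := strip_trans_ge0 hPQR.
(* [d > 0] provides a state of layer 0, the common target [o] in [stationary_le], which is then used
   in both directions. *)
have acc := strip_accessible hPQR (Ordinal hd) hC1 hC3.
apply/funext => n; apply/rowP => i; apply/eqP; rewrite eq_le.
have le := stationary_le p0 (strip_trans_sum1 hPQR) acc.
by rewrite (le _ _ nu_stat nu'_stat (n, i)) (le _ _ nu'_stat nu_stat (n, i)).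
Qed.
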